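(* Let $w_0\in H^1(0,1)$ and let $w_h$ be the semidiscrete finite element solution described in the context, with $\alpha,\beta$ as in the context. Then there is a constant $C>0$, independent of $h$ and $t$, such that for all $t>0$ $$\|w_h(t)\|^2+\mu\|w_{hx}(t)\|^2+\frac{\mu}{\nu}E_{1h}(w_h)(t)+\beta e^{-2\alpha t}\int_0^t e^{2\alpha s}|||w_h(s)|||^2\,ds\le Ce^{-2\alpha t}\Big(\|w_{0h}\|^2+\mu\|w_{0hx}\|^2+\frac{\mu}{\nu}E_{1h}(w_h)(0)\Big),$$ where $$E_{1h}(w_h)(t)=(c_0+1+w_d)w_h^2(0,t)+(c_1+1+w_d)w_h^2(1,t)+\frac{1}{3c_0}w_h^4(0,t)+\frac{1}{3c_1}w_h^4(1,t).$$
   Context: Constants: $\mu>0$, $\nu>0$, $w_d\ge 0$, $c_0>0$, $c_1>0$ (fixed, as is $w_0$). $\|\cdot\|$ and $(\cdot,\cdot)$ are the norm and inner product of $L^2(0,1)$; subscripts $x,t$ denote derivatives; $|||z|||^2=z^2(0)+z^2(1)+\|z_x\|^2$. Finite element space: for a partition $0=x_0<\dots<x_N=1$ with mesh size $h=\max_j(x_j-x_{j-1})$, $V_h$ is the space of continuous functions on $[0,1]$ that are affine on each $(x_{j-1},x_j)$. Semidiscrete solution: $w_h(t)\in V_h$, $t>0$, satisfies $w_h(0)=w_{0h}$ and, for all $\chi\in V_h$, $$(w_{ht},\chi)+\mu(w_{hxt},\chi_x)+\nu(w_{hx},\chi_x)+(1+w_d)(w_{hx},\chi)+(w_hw_{hx},\chi)+\sum_{i=0}^1\Big((1+c_i+w_d)w_h(i,t)+\frac{2}{9c_i}w_h^3(i,t)\Big)\chi(i)+\frac{\mu}{\nu}\sum_{i=0}^1\Big((c_i+1+w_d)w_{ht}(i,t)+\frac{2}{3c_i}w_h^2(i,t)w_{ht}(i,t)\Big)\chi(i)=0.$$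 Here $w_{0h}\in V_h$ is the $H^1$-projection of $w_0$: $(w_{0x}-w_{0hx},\chi_x)+\lambda(w_0-w_{0h},\chi)=0$ for all $\chi\in V_h$, with $\lambda>0$ fixed. The number $\alpha$ is any real with $$0\le\alpha\le\frac12\min\Big\{\frac{\nu}{\mu+1},\ \frac{\nu}{2\mu+\nu},\ \frac{\nu(1+c_i+w_d)}{\nu+(1+c_i+w_d)\mu}\ (i=0,1)\Big\},$$ and $$\beta=\min\Big\{2\big(\nu-\alpha(\mu+1)\big),\ 1-2\alpha\frac{\mu}{\nu},\ (1+c_i+w_d)-2\alpha\Big((1+c_i+w_d)\frac{\mu}{\nu}+1\Big)\ (i=0,1)\Big\}.$$ *)

(* Defs.v *)
From HB Require Import structures.
From mathcomp Require Import all_boot all_order all_algebra.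
From mathcomp Require Import all_classical all_reals all_analysis.

Set Implicit Arguments.
Unset Strict Implicit.
Unset Printing Implicit Defensive.

Import Order.TTheory GRing.Theory Num.Theory.
Import numFieldNormedType.Exports.

Local Open Scope classical_set_scope.
Local Open Scope ring_scope.

(* Functions on [0, 1] are represented by total functions R -> R, and functions
   of space and time by R -> R -> R with time first: (w t x) stands for w(x, t).
   Values outside of [0, 1] (and for t < 0) are never constrained nor used. *)

Section L2.
Context {R : realType}.

Definition dotL2 (f g : R -> R) : R :=
  \int[lebesgue_measure]_(x in `]0, 1[) (f x * g x).

Definition normL2 (f : R -> R) : R := Num.sqrt (dotL2 f f).

Definition inL2 (f : R -> R) : Prop :=
  f \_ `]0, 1[ \in Lfun (@lebesgue_measure R) 2%:E.

(* smooth functions with compact support in the open interval (0, 1) *)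
Definition test_function (phi : R -> R) : Prop :=
  (forall n x, derivable (derive1n n phi) x 1) /\
  closure [set x | phi x != 0] `<=` `]0, 1[.

Definition weak_derivative (w g : R -> R) : Prop :=
  forall phi, test_function phi -> dotL2 w (derive1 phi) = - dotL2 g phi.

Definition inH1 (w : R -> R) : Prop :=
  inL2 w /\ exists2 g, inL2 g & weak_derivative w g.

(* |||z|||^2; for the piecewise affine functions it is applied to, the classical
   derivative exists off the nodes and coincides a.e. with the weak one *)
Definition tripnorm2 (z : R -> R) : R :=
  z 0 ^+ 2 + z 1 ^+ 2 + normL2 (derive1 z) ^+ 2.

End L2.

Section FiniteElements.
Context {R : realType}.

(* The partition 0 = x_0 < x_1 < ... < x_N = 1 is encoded by
   s = [:: x_1; ...; x_N] with itv_partition 0 1 s, so that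
   x_j = nth 0 (0 :: s) j for j <= N = size s. *)
Definition Vh (s : seq R) (v : R -> R) : Prop :=
  {within `[0, 1], continuous v} /\
  forall j, (j < size s)%N -> exists a b : R,
    forall x, x \in `]nth 0 (0 :: s) j, nth 0 (0 :: s) j.+1[ -> v x = a + b * x.

Definition H1_projection (s : seq R) (lambda : R) (w0 w0h : R -> R) : Prop :=
  Vh s w0h /\
  exists g, [/\ inL2 g, weak_derivative w0 g &
    forall chi, Vh s chi ->
      dotL2 (fun x => g x - derive1 w0h x) (derive1 chi) +
      lambda * dotL2 (fun x => w0 x - w0h x) chi = 0].

Definition d_x (w : R -> R -> R) (t x : R) : R := derive1 (w t) x.
Definition d_t (w : R -> R -> R) (t x : R) : R := derive1 (w ^~ x) t.

(* Sums over i : 'I_2 are over the two endpoints i%:R of [0, 1].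
   As Vh s is finite dimensional, continuity and differentiability of the
   Vh-valued map w are the pointwise ones. *)
Definition semidiscrete_solution (mu nu wd : R) (c : 'I_2 -> R)
    (s : seq R) (w0h : R -> R) (w : R -> R -> R) : Prop :=
  [/\ (forall x, x \in `[0, 1] -> w 0 x = w0h x),
      (forall t, 0 < t -> Vh s (w t)),
      (forall x, x \in `[0, 1] -> {within `[0, +oo[, continuous (w ^~ x)}),
      (forall x t, x \in `[0, 1] -> 0 < t -> derivable (w ^~ x) t 1) &
      forall t, 0 < t -> forall chi, Vh s chi ->
        dotL2 (d_t w t) chi
        + mu * dotL2 (d_t (d_x w) t) (derive1 chi)
        + nu * dotL2 (d_x w t) (derive1 chi)
        + (1 + wd) * dotL2 (d_x w t) chi
        + dotL2 (fun x => w t x * d_x w t x) chi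
        + \sum_(i < 2) ((1 + c i + wd) * w t i%:R
                        + 2 / (9 * c i) * w t i%:R ^+ 3) * chi i%:R
        + mu / nu * \sum_(i < 2) ((c i + 1 + wd) * d_t w t i%:R
                        + 2 / (3 * c i) * w t i%:R ^+ 2 * d_t w t i%:R)
                        * chi i%:R = 0].

Definition E1h (wd : R) (c : 'I_2 -> R) (w : R -> R -> R) (t : R) : R :=
  \sum_(i < 2) ((c i + 1 + wd) * w t i%:R ^+ 2 + 1 / (3 * c i) * w t i%:R ^+ 4).

Definition alpha_max (mu nu wd : R) (c : 'I_2 -> R) : R :=
  1 / 2 * Num.min (nu / (mu + 1))
    (\big[Num.min / nu / (2 * mu + nu)]_(i < 2)
       (nu * (1 + c i + wd) / (nu + (1 + c i + wd) * mu))).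

Definition beta (mu nu wd : R) (c : 'I_2 -> R) (alpha : R) : R :=
  Num.min (2 * (nu - alpha * (mu + 1)))
    (\big[Num.min / 1 - 2 * alpha * (mu / nu)]_(i < 2)
       ((1 + c i + wd) - 2 * alpha * ((1 + c i + wd) * (mu / nu) + 1))).

End FiniteElements.

(* Main.v *)
(* Test the semidiscrete equation with [w_h] itself. The convective terms reduce
   to boundary terms: the quadratic one is absorbed by half of [1 + w_d] at the
   left end, the cubic one by
   [|w|^3 / 3 <= c w^2 / 2 + w^4 / (18 c)]. With the Poincare inequality
   [||w||^2 <= |||w|||^2], the energy [Phi] on the left-hand side of the theorem
   satisfies [(exp (2 alpha t) Phi)' <= - beta exp (2 alpha t) |||w|||^2], so that
   [C = 1] works. The time derivative need not be continuous, so this is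
   integrated by the mean value theorem; all spatial integrals are explicit
   functions of the nodal values. *)
Require Import Defs.
From mathcomp Require Import all_boot all_order all_algebra.
From mathcomp Require Import all_classical all_reals all_analysis.
From mathcomp Require Import measurable_realfun ring lra.

Import Order.TTheory GRing.Theory Num.Theory.
Import numFieldNormedType.Exports.

Local Open Scope classical_set_scope.
Local Open Scope ring_scope.

Set Implicit Arguments.
Unset Strict Implicit.

(** * Integration of a differential inequality *)

(** [K] is continuous, so its primitive [F] is differentiable inside the interval, and [G + b * F]
    has a nonpositive derivative there. The mean value theorem makes this sum nonincreasing, without
    integrating the derivative of [G]. *)
Lemma decay_of_derive_le (R : realType) (G K : R -> R) (b t : R) :
  0 < t ->
  {within `[0, t], continuous G} -> {within `[0, t], continuous K} ->
  (forall x, x \in `]0, t[ -> exists2 dG, is_derive x 1 G dG & dG <= - b * K x) ->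
  G t + b * \int[lebesgue_measure]_(x in `[0, t]) K x <= G 0.
Proof.
move=> t0 cG cK dG.
have iK : lebesgue_measure.-integrable `[0, t] (EFin \o K).
  apply: continuous_compact_integrable => //; exact: segment_compact.
pose F x := \int[lebesgue_measure]_(y in `[0, x]) K y.
have [cKi _ _] := (continuous_within_itvP K t0).1 cK.
have dF x : x \in `]0, t[ -> is_derive x 1 F (K x).
  move=> xt; have [x0 lxt] : 0 < x /\ x < t by apply/andP; rewrite in_itv in xt.
  have [dF1 dF2] := continuous_FTC1_closed lxt iK x0 (cKi _ xt).
  by apply: DeriveDef => //; rewrite -derive1E.
have cF : {within `[0, t], continuous F}.
  exact: (parameterized_integral_continuous (ltW t0) iK).
pose H x := G x + b * F x.
have dH x : x \in `]0, t[ -> exists2 d, is_derive x 1 H d & d <= 0.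
  move=> xt; have [d dGx dle] := dG _ xt; have dFx := dF _ xt.
  exists (d + b * K x); first exact: is_deriveD.
  by rewrite -lerBrDr sub0r -mulNr.
have -> : G 0 = H 0 by rewrite /H /F set_itv1 Rintegral_set1 mulr0 addr0.
rewrite -/(F t) -/(H t).
apply: (@ler0_derive1_le_cc _ H 0 t).
- by move=> x /dH[d dHx _]; exact: ex_derive.
- by move=> x /dH[d dHx d0]; rewrite derive1E derive_val.
- apply/subspace_continuousP => x xt; apply: cvgD.
    by move/subspace_continuousP: cG; apply.
  apply: cvgM; first exact: cvg_cst.
  by move/subspace_continuousP: cF; apply.
- by rewrite in_itv /= lexx ltW.
- by rewrite in_itv /= lexx ltW.
- exact: ltW.
Qed.

(** * Exact integrals of products of piecewise affine functions *)

Lemma integrableU d (T : measurableType d) (R : realType)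
    (m : {measure set T -> \bar R}) (A B : set T) (f : T -> \bar R) :
  measurable A -> measurable B -> [disjoint A & B] ->
  m.-integrable A f -> m.-integrable B f -> m.-integrable (A `|` B) f.
Proof.
move=> mA mB dAB /integrableP[mfA iA] /integrableP[mfB iB].
apply/integrableP; split; first by apply/measurable_funU.
rewrite ge0_integral_setU//; first exact: lte_add_pinfty.
by apply/measurable_funU => //; split; exact: measurableT_comp.
Qed.

(* The integral of (p + P y)(q + Q y) over y in (0, d). *)
Definition int_affine2 {R : realType} (d p P q Q : R) : R :=
  d * (p * q + (p * Q + P * q) * d / 2 + P * Q * d ^+ 2 / 3).

(** Viewed as a function of its first argument, [int_affine2] is an antiderivative of the product.
    The hypothesis concerns the open interval only, so it also fits derivatives of piecewise affine
    functions, which may jump at the nodes. *)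
Lemma Rintegral_affine2 (R : realType) (a b p P q Q : R) (f : R -> R) :
  a < b ->
  (forall x, x \in `]a, b[ -> f x = (p + P * (x - a)) * (q + Q * (x - a))) ->
  lebesgue_measure.-integrable `]a, b[ (EFin \o f) /\
  \int[lebesgue_measure]_(x in `]a, b[) f x = int_affine2 (b - a) p P q Q.
Proof.
move=> ab fE.
pose g x : R := (p + P * (x - a)) * (q + Q * (x - a)).
pose G x : R := int_affine2 (x - a) p P q Q.
have dG (x : R) : is_derive x 1 G (g x).
  rewrite /G /int_affine2 /g; apply: is_derive_eq.
  by rewrite /GRing.scale /=; field.
have cg : {within `[a, b], continuous g}.
  apply: continuous_subspaceT => x.
  by apply: cvgM; apply: cvgD; (try exact: cvg_cst); apply: cvgM;
     (try exact: cvg_cst); apply: cvgB; (try exact: cvg_cst); exact: cvg_id.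
have ig : lebesgue_measure.-integrable `[a, b] (EFin \o g).
  apply: continuous_compact_integrable => //; exact: segment_compact.
have ig' : lebesgue_measure.-integrable `[a, b[ (EFin \o g).
  apply: (integrableS _ _ _ ig) => //.
  by move=> x /=; rewrite !in_itv /= => /andP[-> /ltW].
have ig'' : lebesgue_measure.-integrable `]a, b[ (EFin \o g).
  apply: (integrableS _ _ _ ig) => //; exact: subset_itv_oo_cc.
have fg : {in `]a, b[%classic, g =1 f}.
  by move=> x; rewrite inE /= => /fE.
split.
  apply: (eq_integrable _ _ _ _ ig'') => // x /fg.
  by rewrite /= => ->.
transitivity (\int[lebesgue_measure]_(x in `]a, b[) g x).
  by apply/esym/eq_Rintegral.
rewrite Rintegral_itv_obnd_cbnd// Rintegral_itv_bndo_bndc//.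
rewrite /Rintegral (@continuous_FTC2 _ g G)//=.
- by rewrite /G subrr {2}/int_affine2 mul0r subr0.
- split.
  + by move=> x _; exact: ex_derive.
  + apply: cvg_at_right_filter; apply: differentiable_continuous.
    by apply/derivable1_diffP; exact: ex_derive.
  + apply: cvg_at_left_filter; apply: differentiable_continuous.
    by apply/derivable1_diffP; exact: ex_derive.
- by move=> x _; rewrite derive1E derive_val.
Qed.

(** Induction on the nodes with a moving left end [a]. Half-open intervals tile exactly, each right
    end being a null set; integrability is carried along because splitting the integral requires
    it. *)
Lemma Rintegral_piecewise_affine2 (R : realType) (s : seq R) (a : R)
    (p P q Q : nat -> R) (f : R -> R) :
  path <%R a s ->
  (forall j x, (j < size s)%N -> x \in `]nth 0 (a :: s) j, nth 0 (a :: s) j.+1[ ->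
    f x = (p j + P j * (x - nth 0 (a :: s) j)) *
          (q j + Q j * (x - nth 0 (a :: s) j))) ->
  lebesgue_measure.-integrable `]a, last a s] (EFin \o f) /\
  \int[lebesgue_measure]_(x in `]a, last a s]) f x =
  \sum_(j < size s) int_affine2 (nth 0 (a :: s) j.+1 - nth 0 (a :: s) j)
                      (p j) (P j) (q j) (Q j).
Proof.
elim: s a p P q Q => [|b s IH] a p P q Q /=.
  move=> _ _; rewrite big_ord0 set_itv_ge ?bnd_simp ?ltxx//.
  by rewrite Rintegral_set0; split => //; exact: integrable_set0.
case/andP=> ab pbs fE.
have [i1 e1] := Rintegral_affine2 ab (fun x => fE 0%N x isT).
have [|i2 e2] := IH b (p \o S) (P \o S) (q \o S) (Q \o S) pbs.
  by move=> j x js; exact: (fE j.+1 x js).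
have bl : b <= last b s.
  by have := @itv_partition_le _ _ b (last b s) s; apply; split.
have i1' : lebesgue_measure.-integrable `]a, b] (EFin \o f).
  rewrite -(@setUitv1 _ _ (BRight a) b true) ?bnd_simp//.
  apply: integrableU => //.
    by apply/disj_setPS => x [] /=; rewrite in_itv /= => /andP[_ /[swap] ->]; rewrite ltxx.
  by apply/integrableP; split; [exact: measurable_fun_set1|rewrite integral_set1].
have i3 : lebesgue_measure.-integrable `]a, last b s] (EFin \o f).
  rewrite (@itv_bndbnd_setU _ _ (BRight a) (BRight b)) ?bnd_simp ?(ltW ab)//.
  apply: integrableU => //.
  apply/disj_setPS => x [] /=; rewrite !in_itv /=.
  by move=> /andP[_ xb] /andP[/(le_lt_trans xb)]; rewrite ltxx.
split => //.
rewrite big_ord_recl /= -e1 -e2 Rintegral_itv_bndo_bndc//.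
rewrite -(@Rintegral_itvB _ f (BRight a) (BRight (last b s)) b) ?bnd_simp ?(ltW ab)//.
  by rewrite addrC subrK.
Qed.

(** * Nodal interpolation *)

Section NodalInterpolation.
Variables (R : realType) (s : seq R).
Hypothesis part_s : itv_partition 0 1 s.

Definition node (j : nat) : R := nth 0 (0 :: s) j.

Definition mesh (j : nat) : R := node j.+1 - node j.

Definition slope (u : nat -> R) (j : nat) : R := (u j.+1 - u j) / mesh j.

(** Only open cells are constrained; the nodes form a null set for all the integrals below. *)
Definition interpolates (u : nat -> R) (f : R -> R) : Prop :=
  forall j x, (j < size s)%N -> x \in `]node j, node j.+1[ ->
    f x = u j + slope u j * (x - node j).

(** The bilinear form of the mass matrix of the hat functions, as [stiffness] is that of their
    stiffness matrix. *)
Definition mass (u v : nat -> R) : R :=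
  \sum_(j < size s) mesh j * (u j * v j / 3 + u j * v j.+1 / 6
    + u j.+1 * v j / 6 + u j.+1 * v j.+1 / 3).

Definition stiffness (u v : nat -> R) : R :=
  \sum_(j < size s) (u j.+1 - u j) * (v j.+1 - v j) / mesh j.

Lemma node_lt j : (j < size s)%N -> node j < node j.+1.
Proof. by case: part_s => /(pathP 0) + _; exact. Qed.

Lemma mesh_gt0 j : (j < size s)%N -> 0 < mesh j.
Proof. by move=> /node_lt; rewrite subr_gt0. Qed.

Lemma node_size : node (size s) = 1.
Proof. by case: part_s => _ /eqP <-; rewrite (last_nth 0). Qed.

Lemma node_ge0 j : (j <= size s)%N -> 0 <= node j.
Proof.
elim: j => [|j IH] js; first exact: lexx.
by rewrite (le_trans (IH (ltnW js)))// ltW// node_lt.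
Qed.

Lemma node_le1 j : (j <= size s)%N -> node j <= 1.
Proof.
(* Downward induction from the last node. Once [size s - k] is [0], its predecessor is [0] again and
   the induction hypothesis is the goal. *)
rewrite -node_size => js; rewrite -(subKn js).
elim: (size s - j)%N => [|k IH]; first by rewrite subn0.
rewrite subnS; case E: (size s - k)%N IH => [//|m] /= IH.
apply: le_trans IH; apply/ltW/node_lt.
by rewrite -E leq_subr.
Qed.

Lemma node_itv j : (j <= size s)%N -> node j \in `[0, 1].
Proof. by move=> js; rewrite in_itv /= node_ge0 ?node_le1. Qed.

(** Continuity identifies the nodal values with the one-sided limits of the affine function on the
    cell, and these two limits determine its coefficients. *)
Lemma Vh_interpolates v : Vh s v -> interpolates (v \o node) v.
Proof.
case=> cv va j x js xj; have [a [b vE]] := va _ js.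
have ltj := node_lt js.
have cvj : {within `[node j, node j.+1], continuous v}.
  apply: continuous_subspaceW cv => y /=; rewrite !in_itv /= => /andP[y1 y2].
  by rewrite (le_trans (node_ge0 (ltnW js)) y1) (le_trans y2 (node_le1 js)).
have [_ vl vr] := (continuous_within_itvP v ltj).1 cvj.
have ca (z : R) : (a + b * y) @[y --> z] --> a + b * z.
  by apply: cvgD; [exact: cvg_cst|apply: cvgM; [exact: cvg_cst|exact: cvg_id]].
have vjE : v (node j) = a + b * node j.
  apply: (cvg_unique _ vl) => //=.
  apply: cvg_trans (cvg_at_right_filter (ca _)).
  apply: (@near_eq_cvg _ _ ((node j)^'+) _).
  near do apply/esym/vE.
  near=> y; rewrite in_itv /=; apply/andP; split; near: y.
    exact: nbhs_right_gt.
  exact: nbhs_right_lt.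
have vj1E : v (node j.+1) = a + b * node j.+1.
  apply: (cvg_unique _ vr) => //=.
  apply: cvg_trans (cvg_at_left_filter (ca _)).
  apply: (@near_eq_cvg _ _ ((node j.+1)^'-) _).
  near do apply/esym/vE.
  near=> y; rewrite in_itv /=; apply/andP; split; near: y.
    exact: nbhs_left_gt.
  exact: nbhs_left_lt.
rewrite /slope /= vjE vj1E vE// /mesh.
have : node j.+1 - node j != 0 by rewrite subr_eq0 gt_eqF.
by move=> h; field.
Unshelve. all: by end_near. Qed.

Lemma interpolates_derive1 u f j x : interpolates u f ->
  (j < size s)%N -> x \in `]node j, node j.+1[ -> derive1 f x = slope u j.
Proof.
move=> fu js xj; rewrite derive1E.
transitivity ('D_1 (fun y : R => u j + slope u j * (y - node j)) x).
  apply: near_eq_derive; near=> y; apply: fu => //.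
  by near: y; exact: near_in_itvoo.
have d : is_derive (x : R) 1 (fun y : R => u j + slope u j * (y - node j)) (slope u j).
  by apply: is_derive_eq; rewrite /GRing.scale /=; ring.
exact: derive_val.
Unshelve. all: by end_near. Qed.

Lemma dotL2_piecewise_affine (p P q Q : nat -> R) f g :
  (forall j x, (j < size s)%N -> x \in `]node j, node j.+1[ ->
    f x = p j + P j * (x - node j)) ->
  (forall j x, (j < size s)%N -> x \in `]node j, node j.+1[ ->
    g x = q j + Q j * (x - node j)) ->
  dotL2 f g = \sum_(j < size s) int_affine2 (mesh j) (p j) (P j) (q j) (Q j).
Proof.
move=> fE gE; case: (part_s) => ps /eqP ls.
have [|i1 e1] := @Rintegral_piecewise_affine2 R s 0 p P q Q (f \* g) ps.
  by move=> j x js xj; rewrite /= (fE j)// (gE j)//.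
rewrite /dotL2 Rintegral_itv_bndo_bndc -?[X in `]0, X]]ls//.
rewrite -[X in `]0, X[]ls.
by apply: integrableS i1 => // x /=; rewrite !in_itv /= => /andP[-> /ltW].
Qed.

Lemma dotL2_mass u v f g : interpolates u f -> interpolates v g ->
  dotL2 f g = mass u v.
Proof.
move=> fu gv; rewrite (dotL2_piecewise_affine fu gv); apply: eq_bigr => j _.
have := mesh_gt0 (ltn_ord j); rewrite /int_affine2 /slope.
by move=> /lt0r_neq0 h; field.
Qed.

Lemma dotL2_stiffness (u v : nat -> R) f g :
  (forall j x, (j < size s)%N -> x \in `]node j, node j.+1[ -> f x = slope u j) ->
  (forall j x, (j < size s)%N -> x \in `]node j, node j.+1[ -> g x = slope v j) ->
  dotL2 f g = stiffness u v.
Proof.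
move=> fu gv.
rewrite (@dotL2_piecewise_affine (slope u) (fun=> 0) (slope v) (fun=> 0)).
- apply: eq_bigr => j _.
  have := mesh_gt0 (ltn_ord j); rewrite /int_affine2 /slope.
  by move=> /lt0r_neq0 h; field.
- by move=> j x js xj; rewrite mul0r addr0 (fu j).
- by move=> j x js xj; rewrite mul0r addr0 (gv j).
Qed.

Lemma sum_telescope (F : nat -> R) :
  \sum_(j < size s) (F j.+1 - F j) = F (size s) - F 0%N.
Proof. by rewrite -(telescope_sumr F (leq0n _)) big_mkord. Qed.

(** On each cell the integrand is the derivative of half the square of [f], so the cell integrals
    telescope. *)
Lemma dotL2_derive1_self u f : interpolates u f ->
  dotL2 (derive1 f) f = (u (size s) ^+ 2 - u 0%N ^+ 2) / 2.
Proof.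
move=> fu; rewrite (@dotL2_piecewise_affine (slope u) (fun=> 0) u (slope u))//.
  rewrite mulrBl -(@sum_telescope (fun j => u j ^+ 2 / 2)).
  apply: eq_bigr => j _.
  have := mesh_gt0 (ltn_ord j); rewrite /int_affine2 /slope.
  by move=> /lt0r_neq0 h; field.
by move=> j x js xj; rewrite mul0r addr0 (interpolates_derive1 fu js).
Qed.

Lemma dotL2_convection_self u f : interpolates u f ->
  dotL2 (fun x => f x * derive1 f x) f = (u (size s) ^+ 3 - u 0%N ^+ 3) / 3.
Proof.
move=> fu.
(* On a cell [f * derive1 f] is again affine, with slope [slope u j ^+ 2], so the formula for two
   affine factors covers this triple product. *)
rewrite (@dotL2_piecewise_affine (fun j => u j * slope u j)
  (fun j => slope u j ^+ 2) u (slope u))//.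
  rewrite mulrBl -(@sum_telescope (fun j => u j ^+ 3 / 3)).
  apply: eq_bigr => j _.
  have := mesh_gt0 (ltn_ord j); rewrite /int_affine2 /slope.
  by move=> /lt0r_neq0 h; field.
move=> j x js xj; rewrite (interpolates_derive1 fu js)// (fu j)//; ring.
Qed.

Lemma stiffness_ge0 u : 0 <= stiffness u u.
Proof.
by apply: sumr_ge0 => j _; rewrite -expr2 divr_ge0 ?sqr_ge0// ltW// mesh_gt0.
Qed.

(* Integrating [((2 x - 1) w^2)'] over (0, 1) and using
   [- 2 (2 x - 1) w w_x <= w^2 + w_x^2]; here cell by cell. *)
Lemma poincare u :
  mass u u <= u 0%N ^+ 2 + u (size s) ^+ 2 + stiffness u u.
Proof.
(* The weight [2 x - 1] equals [-1] at [0] and [1] at [1], which makes the boundary squares a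
   telescoping sum. *)
have -> : u 0%N ^+ 2 + u (size s) ^+ 2 =
    \sum_(j < size s) ((2 * node j.+1 - 1) * u j.+1 ^+ 2
                       - (2 * node j - 1) * u j ^+ 2).
  rewrite (@sum_telescope (fun j => (2 * node j - 1) * u j ^+ 2)) node_size.
  have -> : node 0 = 0 by [].
  ring.
rewrite -big_split; apply: ler_sum => j _ /=.
have h0 := mesh_gt0 (ltn_ord j).
have a0 := node_ge0 (ltnW (ltn_ord j)); have b1 := node_le1 (ltn_ord j).
have bE : node j.+1 = node j + mesh j by rewrite /mesh addrC subrK.
rewrite bE in b1 *.
have -> : u j.+1 = u j + slope u j * mesh j by rewrite /slope divfK ?gt_eqF// addrC subrK.
move: (node j) (mesh j) (u j) (slope u j) h0 a0 b1 => a d p P d0 a0 b1.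
(* On a cell, with w = p + P (x - a), the difference of the two sides is the integral of (w + (2 x -
   1) P)^2 plus that of 4 x (1 - x) P^2. The first is [h1]: the square of an affine function with
   end values X, Y integrates to d (X^2 + X Y + Y^2) / 3. The second is [h2]. *)
have sq (X Y : R) : 0 <= X ^+ 2 + X * Y + Y ^+ 2 by nra.
have h1 := mulr_ge0 (divr_ge0 (ltW d0) (ler0n R 3)) (sq (p + (2 * a - 1) * P)
  (p + P * d + (2 * (a + d) - 1) * P)).
have h2 : 0 <= d * P ^+ 2 * (4 * a * (1 - (a + d)) + 2 * d - 4 / 3 * d ^+ 2).
  apply: mulr_ge0; first by apply: mulr_ge0; [exact: ltW|exact: sqr_ge0].
  have h3 : 0 <= a * (1 - (a + d)) by apply: mulr_ge0; lra.
  have h4 : 0 <= d * (1 - d) by apply: mulr_ge0; lra.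
  by lra.
rewrite -subr_ge0; apply: le_trans (addr_ge0 h1 h2) _.
by rewrite le_eqVlt; apply/orP; left; apply/eqP; field; rewrite gt_eqF.
Qed.

End NodalInterpolation.

(** * Time dependence *)

Section TimeDependence.
Variables (R : realType) (s : seq R).

(** The form is symmetric, so the two terms of the product rule merge into the factor [2]. *)
Lemma is_derive_mass (W : R -> nat -> R) (D : nat -> R) (t : R) :
  (forall j, (j <= size s)%N -> is_derive t 1 (W ^~ j) (D j)) ->
  is_derive t 1 (fun x => mass s (W x) (W x)) (2 * mass s D (W t)).
Proof.
move=> dW; rewrite /mass mulr_sumr.
rewrite (_ : (fun x => _) = \sum_(j < size s) (fun x => mesh s j *
   (W x j * W x j / 3 + W x j * W x j.+1 / 6
    + W x j.+1 * W x j / 6 + W x j.+1 * W x j.+1 / 3))); last first.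
  by apply/funext => x; rewrite fct_sumE.
apply: is_derive_sum => j.
have d1 := dW j (ltnW (ltn_ord j)); have d2 := dW j.+1 (ltn_ord j).
by apply: is_derive_eq; rewrite /GRing.scale /=; field.
Qed.

Lemma is_derive_stiffness (W : R -> nat -> R) (D : nat -> R) (t : R) :
  (forall j, (j <= size s)%N -> is_derive t 1 (W ^~ j) (D j)) ->
  is_derive t 1 (fun x => stiffness s (W x) (W x)) (2 * stiffness s D (W t)).
Proof.
move=> dW; rewrite /stiffness mulr_sumr.
rewrite (_ : (fun x => _) = \sum_(j < size s) (fun x =>
  (W x j.+1 - W x j) * (W x j.+1 - W x j) * (mesh s j)^-1)); last first.
  by apply/funext => x; rewrite fct_sumE.
apply: is_derive_sum => j.
have d1 := dW j (ltnW (ltn_ord j)); have d2 := dW j.+1 (ltn_ord j).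
by apply: is_derive_eq; rewrite /GRing.scale /=; ring.
Qed.

(** Stated for any filter, so that it applies to convergence within [[0, t]], in particular at time
    [0]. *)
Lemma cvg_mass (W : R -> nat -> R) (u : nat -> R) (F : set_system R) :
  Filter F ->
  (forall j, (j <= size s)%N -> W x j @[x --> F] --> u j) ->
  mass s (W x) (W x) @[x --> F] --> mass s u u.
Proof.
move=> FF cW; apply: (cvg_big (op := +%R) add_continuous) => j _.
have c1 := cW j (ltnW (ltn_ord j)); have c2 := cW j.+1 (ltn_ord j).
apply: cvgM; first exact: cvg_cst.
by repeat apply: cvgD; apply: cvgM; (try exact: cvg_cst); exact: cvgM.
Qed.

Lemma cvg_stiffness (W : R -> nat -> R) (u : nat -> R) (F : set_system R) :
  Filter F ->
  (forall j, (j <= size s)%N -> W x j @[x --> F] --> u j) ->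
  stiffness s (W x) (W x) @[x --> F] --> stiffness s u u.
Proof.
move=> FF cW; apply: (cvg_big (op := +%R) add_continuous) => j _.
have c1 := cW j (ltnW (ltn_ord j)); have c2 := cW j.+1 (ltn_ord j).
by apply: cvgM; [apply: cvgM; exact: cvgB|exact: cvg_cst].
Qed.

Hypothesis part_s : itv_partition 0 1 s.

Variable w : R -> R -> R.
Hypothesis w_Vh : forall t : R, 0 < t -> Vh s (w t).
Hypothesis w_derivable :
  forall x t : R, x \in `[0, 1] -> 0 < t -> derivable (w ^~ x) t 1.

Lemma is_derive_node j (t : R) : (j <= size s)%N -> 0 < t ->
  is_derive t 1 (fun x => w x (node s j)) (d_t w t (node s j)).
Proof.
move=> js t0; apply: DeriveDef; last by rewrite /d_t derive1E.
by apply: w_derivable => //; exact: node_itv.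
Qed.

(** At a fixed [x], all [w y x] with [y] near [t] are the same linear combination of two nodal
    values; differentiating it in time keeps the affine shape in [x]. *)
Lemma d_t_interpolates (t : R) : 0 < t ->
  interpolates s (d_t w t \o node s) (d_t w t).
Proof.
move=> t0 j x js xj; rewrite [LHS]/d_t derive1E.
have d1 := is_derive_node (ltnW js) t0; have d2 := is_derive_node js t0.
have d : is_derive (t : R) 1 (fun y => w y (node s j) +
    (w y (node s j.+1) - w y (node s j)) * (mesh s j)^-1 * (x - node s j))
    (d_t w t (node s j) + slope s (d_t w t \o node s) j * (x - node s j)).
  by apply: is_derive_eq; rewrite /slope /GRing.scale /=; ring.
rewrite -[RHS](@derive_val _ _ _ _ _ _ _ d).
apply: near_eq_derive; near=> y.
have y0 : 0 < y by near: y; exact: lt_nbhsr.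
by rewrite (Vh_interpolates part_s (w_Vh y0) js xj).
Unshelve. all: by end_near. Qed.

(** On a cell [d_x w] is a fixed difference quotient of nodal values, so the time derivative passes
    through it. *)
Lemma d_t_d_x j (x t : R) : 0 < t -> (j < size s)%N ->
  x \in `]node s j, node s j.+1[ ->
  d_t (d_x w) t x = slope s (d_t w t \o node s) j.
Proof.
move=> t0 js xj; rewrite [LHS]/d_t derive1E.
have d1 := is_derive_node (ltnW js) t0; have d2 := is_derive_node js t0.
have d : is_derive (t : R) 1 (fun y =>
    (w y (node s j.+1) - w y (node s j)) * (mesh s j)^-1)
    (slope s (d_t w t \o node s) j).
  by apply: is_derive_eq; rewrite /slope /GRing.scale /=; ring.
rewrite -[RHS](@derive_val _ _ _ _ _ _ _ d).
apply: near_eq_derive; near=> y.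
have y0 : 0 < y by near: y; exact: lt_nbhsr.
by rewrite /d_x (interpolates_derive1 (Vh_interpolates part_s (w_Vh y0)) js xj).
Unshelve. all: by end_near. Qed.

End TimeDependence.

(** * The differential inequality for the energy, as pure algebra *)

(** [M], [S], [M'], [S'] stand for ||w||^2, ||w_x||^2, (w_t, w), (w_xt, w_x), and [v0], [v1] for the
    time derivatives of the end values [w0], [w1]. The equation is the scheme tested with w; the
    conclusion reads 2 alpha Phi + Phi' <= - beta |||w|||^2. *)
Lemma damped_energy_derivative_le (R : realFieldType)
    (mu nu wd c0 c1 al be w0 w1 v0 v1 M S M' S' : R) :
  0 < nu -> 0 <= wd -> 0 < c0 -> 0 < c1 -> 0 <= al ->
  be <= 2 * (nu - al * (mu + 1)) ->
  be <= (1 + c0 + wd) - 2 * al * ((1 + c0 + wd) * (mu / nu) + 1) ->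
  be <= (1 + c1 + wd) - 2 * al * ((1 + c1 + wd) * (mu / nu) + 1) ->
  2 * al * (mu / nu) <= 1 ->
  0 <= S -> M <= w0 ^+ 2 + w1 ^+ 2 + S ->
  M' + mu * S' + nu * S + (1 + wd) * ((w1 ^+ 2 - w0 ^+ 2) / 2)
    + (w1 ^+ 3 - w0 ^+ 3) / 3
    + (((1 + c0 + wd) * w0 + 2 / (9 * c0) * w0 ^+ 3) * w0
       + ((1 + c1 + wd) * w1 + 2 / (9 * c1) * w1 ^+ 3) * w1)
    + mu / nu * (((c0 + 1 + wd) * v0 + 2 / (3 * c0) * w0 ^+ 2 * v0) * w0
       + ((c1 + 1 + wd) * v1 + 2 / (3 * c1) * w1 ^+ 2 * v1) * w1) = 0 ->
  2 * al * (M + mu * S + mu / nu *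
      (((c0 + 1 + wd) * w0 ^+ 2 + 1 / (3 * c0) * w0 ^+ 4)
       + ((c1 + 1 + wd) * w1 ^+ 2 + 1 / (3 * c1) * w1 ^+ 4)))
  + (2 * M' + mu * (2 * S') + mu / nu *
      (((c0 + 1 + wd) * (2 * w0 * v0) + 1 / (3 * c0) * (4 * w0 ^+ 3 * v0))
       + ((c1 + 1 + wd) * (2 * w1 * v1) + 1 / (3 * c1) * (4 * w1 ^+ 3 * v1))))
  <= - be * (w0 ^+ 2 + w1 ^+ 2 + S).
Proof.
move=> nu0 wd0 c0p c1p al0 b1 b2 b3 kle S0 MS.
(* Isolating the inverses of [c0] and [c1] lets them later become plain variables, so that the final
   goal is linear in its monomials. *)
have rE (x y : R) : y / (x * c0) = y / x * c0^-1 by rewrite invfM mulrA.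
have rE' (x y : R) : y / (x * c1) = y / x * c1^-1 by rewrite invfM mulrA.
rewrite !{}rE !{}rE'.
move: (mu / nu) b2 b3 kle => k b2 b3 kle.
have cube (c x : R) : 0 < c -> 0 <= c^-1 / 18 * x ^+ 4 + x ^+ 3 / 3 + c / 2 * x ^+ 2.
  move=> cp; rewrite (_ : _ + _ = c^-1 / 18 * (x * (x + 3 * c)) ^+ 2).
    by rewrite mulr_ge0 ?sqr_ge0// divr_ge0// invr_ge0 ltW.
  by field; rewrite gt_eqF.
(* The cubic boundary term has opposite signs at the two ends, hence [- w0] but [w1]. *)
have q0 := cube _ (- w0) c0p; have q1 := cube _ w1 c1p.
(* Doubling the tested equation yields 4 / (9 c) of dissipation in x^4. The damping costs 2 alpha k
   / (3 c) <= 1 / (3 c), and the remaining 1 / (9 c) is what twice [cube] consumes. *)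
have quart (c x : R) : 0 < c -> 0 <= (1 - 2 * al * k) * (c^-1 * x ^+ 4).
  move=> cp; rewrite mulr_ge0 ?subr_ge0// mulr_ge0 ?invr_ge0 ?(ltW cp)//.
  by rewrite -[4%N]/(2 * 2)%N exprM sqr_ge0.
have p0 := quart _ w0 c0p; have p1 := quart _ w1 c1p.
move: (c0^-1) (c1^-1) q0 q1 p0 p1 => r0 r1 q0 q1 p0 p1 eq.
have e1 := ler_wpM2r S0 b1.
have e2 := ler_wpM2r (sqr_ge0 w0) b2.
have e3 := ler_wpM2r (sqr_ge0 w1) b3.
have e4 := ler_wpM2l al0 MS.
have e5 : 0 <= (1 + wd) * w1 ^+ 2 by rewrite mulr_ge0 ?sqr_ge0// addr_ge0.
lra.
Qed.

(** * Energy decay of the semidiscrete solution *)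

Lemma sqr_normL2 (R : realType) (f : R -> R) : normL2 f ^+ 2 = dotL2 f f.
Proof.
by rewrite sqr_sqrtr// /dotL2 Rintegral_ge0// => x _; rewrite -expr2 sqr_ge0.
Qed.

(** Serves time [0], where the solution is only known to agree with [w0h] on [[0, 1]]; the nodes lie
    there. *)
Lemma interpolates_eq (R : realType) (s : seq R) (f g : R -> R) :
  itv_partition 0 1 s -> {in `[0, 1], f =1 g} ->
  interpolates s (g \o node s) g ->
  interpolates s (f \o node s) g /\ interpolates s (f \o node s) f.
Proof.
move=> ps fg gI.
have fgI : interpolates s (f \o node s) g.
  move=> j x js xj; rewrite (gI j x js xj) /slope /= !fg//.
    exact: node_itv.
  exact/node_itv/ltnW.
split=> // j x js xj; rewrite -(fgI j x js xj) fg//.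
move: xj; rewrite !in_itv /= => /andP[jx xj].
have := node_ge0 ps (ltnW js); have := node_le1 ps js.
by move=> h1 h2; rewrite (le_trans h2 (ltW jx)) (le_trans (ltW xj) h1).
Qed.

Lemma ord2_sumE (R : realType) (F : 'I_2 -> R) :
  \sum_(i < 2) F i = F ord0 + F ord_max.
Proof.
rewrite big_ord_recr big_ord1; congr (F _ + _); exact/val_inj.
Qed.

(** The estimate before division by the integrating factor. Only upper bounds on [b] enter, which
    keeps the minima defining [beta] and [alpha_max] out of the argument. *)
Lemma semidiscrete_energy_decay (R : realType) (mu nu wd : R) (c : 'I_2 -> R)
    (alpha b : R) (s : seq R) (w0h : R -> R) (w : R -> R -> R) (t : R) :
  0 < nu -> 0 <= wd -> (forall i, 0 < c i) -> 0 <= alpha ->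
  b <= 2 * (nu - alpha * (mu + 1)) ->
  (forall i, b <= (1 + c i + wd) - 2 * alpha * ((1 + c i + wd) * (mu / nu) + 1)) ->
  2 * alpha * (mu / nu) <= 1 ->
  itv_partition 0 1 s -> Vh s w0h ->
  semidiscrete_solution mu nu wd c s w0h w -> 0 < t ->
  expR (2 * alpha * t) * (normL2 (w t) ^+ 2 + mu * normL2 (d_x w t) ^+ 2
    + mu / nu * E1h wd c w t)
  + b * \int[lebesgue_measure]_(tau in `[0, t])
          (expR (2 * alpha * tau) * tripnorm2 (w tau))
  <= normL2 w0h ^+ 2 + mu * normL2 (derive1 w0h) ^+ 2 + mu / nu * E1h wd c w 0.
Proof.
move=> nu0 wd0 c0 al0 b1 b2 ale ps Vw0h [w0E wV wC wD weq] t0.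
pose W (x : R) (j : nat) : R := w x (node s j).
have [w0h_int w0_int] := interpolates_eq ps w0E (Vh_interpolates ps Vw0h).
have w_int x : 0 <= x -> interpolates s (W x) (w x).
  rewrite le_eqVlt => /orP[/eqP <- //|x0]; exact: Vh_interpolates (wV _ x0).
have stiffE u f : interpolates s u f ->
    normL2 (derive1 f) ^+ 2 = stiffness s u u.
  move=> fu; rewrite sqr_normL2; apply: dotL2_stiffness => // j x js xj.
    exact: interpolates_derive1 fu js xj.
  exact: interpolates_derive1 fu js xj.
have massE u f : interpolates s u f -> normL2 f ^+ 2 = mass s u u.
  by move=> fu; rewrite sqr_normL2; exact: dotL2_mass.
(* In terms of nodal values, [Phi] and [K] are built from finitely many functions of time by
   arithmetic and [expR]; continuity and derivatives follow termwise. *)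
pose Phi (x : R) := mass s (W x) (W x) + mu * stiffness s (W x) (W x)
  + mu / nu * E1h wd c w x.
pose K (x : R) := expR (2 * alpha * x) *
  (W x 0%N ^+ 2 + W x (size s) ^+ 2 + stiffness s (W x) (W x)).
pose G (x : R) := expR (2 * alpha * x) * Phi x.
have -> : \int[lebesgue_measure]_(tau in `[0, t])
    (expR (2 * alpha * tau) * tripnorm2 (w tau)) =
    \int[lebesgue_measure]_(tau in `[0, t]) K tau.
  apply: eq_Rintegral => x; rewrite inE /= in_itv /= => /andP[x0 _].
  by rewrite /K /tripnorm2 (stiffE _ _ (w_int _ x0)) /W node_size.
have m1 := massE _ _ (w_int _ (ltW t0)).
have m0 := massE _ _ w0h_int.
have s1 : normL2 (d_x w t) ^+ 2 = stiffness s (W t) (W t).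
  exact: (stiffE _ _ (w_int _ (ltW t0))).
have s0 := stiffE _ _ w0h_int.
apply: (@le_trans _ _
  (G t + b * \int[lebesgue_measure]_(tau in `[0, t]) K tau)).
  by rewrite lerD2r m1 s1.
apply: (@le_trans _ _ (Phi 0)); last by rewrite m0 s0.
have -> : Phi 0 = G 0 by rewrite /G mulr0 expR0 mul1r.
have cW x j : (j <= size s)%N -> x \in `[0, t] ->
    W y j @[y --> within `[0, t] (nbhs x)] --> W x j.
  move=> js xt; move: x xt; apply/subspace_continuousP.
  apply: continuous_subspaceW (wC _ (node_itv ps js)) => y /=.
  by rewrite !in_itv /= => /andP[->].
have cE x : expR (2 * alpha * y) @[y --> within `[0, t] (nbhs x)] -->
    expR (2 * alpha * x).
  apply: cvg_within_filter; apply: continuous_comp; last exact: continuous_expR.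
  by apply: cvgM; [exact: cvg_cst|exact: cvg_id].
apply: decay_of_derive_le => //.
- apply/subspace_continuousP => x xt; apply: cvgM; first exact: cE.
  apply: cvgD; first apply: cvgD.
  + by apply: cvg_mass => j js; exact: cW.
  + apply: cvgM; first exact: cvg_cst.
    by apply: cvg_stiffness => j js; exact: cW.
  + apply: cvgM; first exact: cvg_cst.
    apply: (cvg_big (op := +%R) add_continuous) => i _.
    have ci : w y i%:R @[y --> within `[0, t] (nbhs x)] --> w x i%:R.
      case: i => -[|[|//]] /= _; first exact: (cW x 0%N).
      by have := cW x _ (leqnn _) xt; rewrite /W node_size.
    by apply: cvgD; apply: cvgM; (try exact: cvg_cst);
      exact: (continuous_cvg _ (@exprn_continuous _ _ _)).
- apply/subspace_continuousP => x xt; apply: cvgM; first exact: cE.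
  apply: cvgD; first apply: cvgD.
  + by apply: (continuous_cvg _ (@exprn_continuous _ _ _)); exact: cW.
  + by apply: (continuous_cvg _ (@exprn_continuous _ _ _)); exact: cW.
  + by apply: cvg_stiffness => j js; exact: cW.
- move=> x; rewrite in_itv /= => /andP[x0 _].
  have wI := w_int _ (ltW x0).
  pose D := d_t w x \o node s.
  have dW j : (j <= size s)%N -> is_derive x 1 (W ^~ j) (D j).
    by move=> js; exact: is_derive_node.
  have dM := is_derive_mass dW; have dS := is_derive_stiffness dW.
  have d0 : is_derive x 1 (w ^~ 0%:R) (d_t w x 0%:R) by exact: (dW 0%N).
  have d1 : is_derive x 1 (w ^~ 1%:R) (d_t w x 1%:R).
    by have := dW _ (leqnn _); rewrite /W /D /= node_size.
  pose dE := (c ord0 + 1 + wd) * (2 * w x 0%:R * d_t w x 0%:R)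
     + 1 / (3 * c ord0) * (4 * w x 0%:R ^+ 3 * d_t w x 0%:R)
     + ((c ord_max + 1 + wd) * (2 * w x 1%:R * d_t w x 1%:R)
     + 1 / (3 * c ord_max) * (4 * w x 1%:R ^+ 3 * d_t w x 1%:R)).
  have dE1 : is_derive x 1 (E1h wd c w) dE.
    rewrite (_ : E1h wd c w = fun y =>
      ((c ord0 + 1 + wd) * w y 0%:R ^+ 2 + 1 / (3 * c ord0) * w y 0%:R ^+ 4)
      + ((c ord_max + 1 + wd) * w y 1%:R ^+ 2
         + 1 / (3 * c ord_max) * w y 1%:R ^+ 4)); last first.
      by apply/funext => y; rewrite /E1h ord2_sumE.
    by apply: is_derive_eq; rewrite /dE /GRing.scale /=; ring.
  have dexp : is_derive x 1 (fun y : R => expR (2 * alpha * y))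
      (expR (2 * alpha * x) * (2 * alpha)).
    by apply: is_derive_eq; rewrite /GRing.scale /=; ring.
  pose dPhi := 2 * mass s D (W x) + mu * (2 * stiffness s D (W x))
    + mu / nu * dE.
  have dP : is_derive x 1 Phi dPhi.
    by apply: is_derive_eq; rewrite /dPhi /GRing.scale /=; ring.
  exists (expR (2 * alpha * x) * (2 * alpha * Phi x + dPhi)).
    by apply: is_derive_eq; rewrite /GRing.scale /=; ring.
  (* After cancelling the exponential, the goal is the algebraic inequality; the scheme is then
     tested with [chi = w x]. *)
  rewrite /K mulrCA ler_wpM2l ?expR_ge0//.
  have := weq _ x0 _ (wV _ x0).
  rewrite (dotL2_mass ps (d_t_interpolates ps wV wD x0) wI).
  rewrite (@dotL2_stiffness _ _ ps D (W x)); last 2 first.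
  + by move=> j y js yj; exact: d_t_d_x.
  + by move=> j y js yj; exact: interpolates_derive1 wI js yj.
  rewrite -[dotL2 (d_x w x) (derive1 (w x))]sqr_normL2 (stiffE _ _ wI).
  rewrite (dotL2_derive1_self ps wI) (dotL2_convection_self ps wI) !ord2_sumE.
  have -> : W x 0%N = w x 0%:R by [].
  have -> : W x (size s) = w x 1%:R by rewrite /W node_size.
  move=> eq.
  rewrite /Phi /E1h ord2_sumE /dPhi /dE.
  apply: (damped_energy_derivative_le nu0 wd0 (c0 ord0) (c0 ord_max) al0 b1
    (b2 ord0) (b2 ord_max) ale _ _ eq).
  + exact: stiffness_ge0.
  + have := poincare ps (W x); rewrite /W node_size; exact.
Qed.

Lemma divide_integrating_factor (R : realFieldType) (e e' b X I Y : R) :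
  0 < e' -> e' * e = 1 -> e * X + b * I <= Y ->
  X + b * e' * I <= 1 * e' * Y.
Proof.
move=> e'0 ee; rewrite -(ler_pM2l e'0) mulrDr mulrA ee !mul1r.
by rewrite mulrCA mulrA.
Qed.

Unset Implicit Arguments.
Set Strict Implicit.

Theorem lemma3p1 (R : realType) (mu nu wd lambda : R) (c : 'I_2 -> R)
    (w0 : R -> R) (alpha : R)
    (mu_gt0 : 0 < mu) (nu_gt0 : 0 < nu) (wd_ge0 : 0 <= wd)
    (lambda_gt0 : 0 < lambda) (c_gt0 : forall i, 0 < c i)
    (w0_H1 : inH1 w0)
    (alpha_range : 0 <= alpha <= alpha_max mu nu wd c) :
  exists2 C : R, 0 < C &
    forall (s : seq R) (w0h : R -> R) (wh : R -> R -> R),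
      itv_partition 0 1 s ->
      H1_projection s lambda w0 w0h ->
      semidiscrete_solution mu nu wd c s w0h wh ->
      forall t : R, 0 < t ->
        normL2 (wh t) ^+ 2 + mu * normL2 (d_x wh t) ^+ 2
        + mu / nu * E1h wd c wh t
        + beta mu nu wd c alpha * expR (- (2 * alpha * t))
          * \int[lebesgue_measure]_(tau in `[0, t])
              (expR (2 * alpha * tau) * tripnorm2 (wh tau))
        <= C * expR (- (2 * alpha * t))
           * (normL2 w0h ^+ 2 + mu * normL2 (derive1 w0h) ^+ 2
              + mu / nu * E1h wd c wh 0).
Proof.
exists 1 => // s w0h w ps [Vw0h _] sol t t0.
have /andP[al0 ale] := alpha_range.
(* The default value of each iterated minimum is itself one of the quantities being minimized, so
   its bound is used as well. *)
have bigmin_le (x0 : R) (F : 'I_2 -> R) :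
    \big[Num.min/x0]_(i < 2) F i <= x0 /\
    forall i, \big[Num.min/x0]_(i < 2) F i <= F i.
  split=> [|i]; last exact: bigmin_le_cond.
  exact: bigmin_le_id.
(* The bound on [alpha] reads 2 alpha mu + alpha nu <= nu / 2, hence 2 alpha mu <= nu; this fixes
   the sign of the quartic boundary terms. *)
have mu_nu_le : 2 * alpha * (mu / nu) <= 1.
  have : alpha <= 1 / 2 * (nu / (2 * mu + nu)).
    apply: le_trans ale _; rewrite ler_pM2l ?divr_gt0// ge_min.
    by rewrite (bigmin_le _ _).1 orbT.
  move=> h; rewrite mulrA ler_pdivlMr ?addr_gt0 ?mulr_gt0// in h.
  rewrite mulrA ler_pdivrMr// mul1r.
  have : 0 <= alpha * nu by rewrite mulr_ge0// ltW.
  lra.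
have b1 : beta mu nu wd c alpha <= 2 * (nu - alpha * (mu + 1)).
  by rewrite /beta ge_min lexx.
have b2 i : beta mu nu wd c alpha <=
    (1 + c i + wd) - 2 * alpha * ((1 + c i + wd) * (mu / nu) + 1).
  by rewrite /beta ge_min (bigmin_le _ _).2 orbT.
apply: (divide_integrating_factor (e := expR (2 * alpha * t))).
- exact: expR_gt0.
- by rewrite -expRD addNr expR0.
- exact: (semidiscrete_energy_decay nu_gt0 wd_ge0 c_gt0 al0 b1 b2 mu_nu_le ps).
Qed.
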